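(* Let $U$ be the forgetful functor from the category $\infty\text{-}\mathbb{C}\mathbb{E}\mathrm{tC}$ of cubical categorical stretchings to the category $\mathbb{C}\mathrm{Sets}$ of cubical sets, sending a stretching $(M,C,\pi,([-;-]^n_{n+1,j}),([-;-]^{n,\gamma}_{n+1,j}))$ to the underlying cubical set of $M$. Then $U$ has a left adjoint, and hence the adjunction produces a monad $\mathbb{W}=(W,\eta,\nu)$ on $\mathbb{C}\mathrm{Sets}$.
   Context: **Cubical sets.** A cubical set is a family of sets $(C_n)_{n\ge 0}$ with maps (sources and targets) $s^n_{n-1,j},t^n_{n-1,j}:C_n\to C_{n-1}$ for $n\ge1$, $1\le j\le n$, such that for $1\le i<j\le n$: $s^{n-1}_{n-2,i}s^n_{n-1,j}=s^{n-1}_{n-2,j-1}s^n_{n-1,i}$; $s^{n-1}_{n-2,i}t^n_{n-1,j}=t^{n-1}_{n-2,j-1}s^n_{n-1,i}$; $t^{n-1}_{n-2,i}s^n_{n-1,j}=s^{n-1}_{n-2,j-1}t^n_{n-1,i}$; $t^{n-1}_{n-2,i}t^n_{n-1,j}=t^{n-1}_{n-2,j-1}t^n_{n-1,i}$. Morphisms are families of maps commuting with all sources and targets. The category is $\mathbb{C}\mathrm{Sets}$. **Reflexive cubical sets.** A reflexive cubical set is a cubical set with maps $1^{n}_{n+1,j}:C_n\to C_{n+1}$ ($n\ge0$, $1\le j\le n+1$; classical reflexions) and $1^{n,\gamma}_{n+1,j}:C_n\to C_{n+1}$ ($n\ge1$, $1\le j\le n$, $\gamma\in\{+,-\}$; connections)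 such that, whenever the maps are defined (and with $r$ denoting either $s$ everywhere or $t$ everywhere): - $1^n_{n+1,i}1^{n-1}_{n,j}=1^n_{n+1,j+1}1^{n-1}_{n,i}$ for $1\le i\le j\le n$; - $r^n_{n-1,i}1^{n-1}_{n,j}=1^{n-2}_{n-1,j-1}r^{n-1}_{n-2,i}$ for $1\le i<j\le n$; $=1^{n-2}_{n-1,j}r^{n-1}_{n-2,i-1}$ for $1\le j<i\le n$; $=\mathrm{id}$ for $i=j$; - $1^{n,\gamma}_{n+1,i}1^{n-1,\gamma}_{n,j}=1^{n,\gamma}_{n+1,j+1}1^{n-1,\gamma}_{n,i}$ for $1\le i<j\le n-1$, and $1^{n,\gamma}_{n+1,i}1^{n-1,\gamma}_{n,i}=1^{n,\gamma}_{n+1,i+1}1^{n-1,\gamma}_{n,i}$ for $1\le i\le n-1$; - $1^{n,\gamma}_{n+1,i}1^{n-1}_{n,j}=1^n_{n+1,j+1}1^{n-1,\gamma}_{n,i}$ for $1\le i<j\le n$; $=1^n_{n+1,j}1^{n-1,\gamma}_{n,i-1}$ for $1\le j<i\le n$; and $1^{n,\gamma}_{n+1,j}1^{n-1}_{n,j}=1^n_{n+1,j}1^{n-1}_{n,j}$ for $1\le j\le n$; - $r^n_{n-1,i}1^{n-1,\gamma}_{n,j}=1^{n-2,\gamma}_{n-1,j-1}r^{n-1}_{n-2,i}$ for $1\le i<j\le n-1$; $=1^{n-2,\gamma}_{n-1,j}r^{n-1}_{n-2,i-1}$ for $2\le j+1<i\le n$; - for $1\le j\le n-1$: $s^n_{n-1,j}1^{n-1,-}_{n,j}=s^n_{n-1,j+1}1^{n-1,-}_{n,j}=\mathrm{id}$,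 $t^n_{n-1,j}1^{n-1,+}_{n,j}=t^n_{n-1,j+1}1^{n-1,+}_{n,j}=\mathrm{id}$, $s^n_{n-1,j}1^{n-1,+}_{n,j}=s^n_{n-1,j+1}1^{n-1,+}_{n,j}=1^{n-2}_{n-1,j}s^{n-1}_{n-2,j}$, $t^n_{n-1,j}1^{n-1,-}_{n,j}=t^n_{n-1,j+1}1^{n-1,-}_{n,j}=1^{n-2}_{n-1,j}t^{n-1}_{n-2,j}$. **Cubical reflexive $\infty$-magmas.** A reflexive cubical set with partial operations $\circ^n_j$ on $C_n$ ($n\ge1$, $1\le j\le n$), where $a\circ^n_jb$ is defined exactly when $t^n_{n-1,j}(a)=s^n_{n-1,j}(b)$, such that $s^n_{n-1,j}(a\circ^n_jb)=s^n_{n-1,j}(a)$, $t^n_{n-1,j}(a\circ^n_jb)=t^n_{n-1,j}(b)$, and for $r\in\{s,t\}$: $r^n_{n-1,i}(a\circ^n_jb)=r^n_{n-1,i}(a)\circ^{n-1}_{j-1}r^n_{n-1,i}(b)$ if $i<j$, and $=r^n_{n-1,i}(a)\circ^{n-1}_{j}r^n_{n-1,i}(b)$ if $j<i$. Morphisms are maps commuting with sources, targets, reflexions, connections and the operations $\circ^n_j$. The category is $\infty\text{-}\mathbb{C}\mathbb{M}\mathrm{ag}_r$. **Strict cubical $\infty$-categories.** A strict cubical $\infty$-category is a cubical reflexive $\infty$-magma such that the operations are associative and unital ($1^{n-1}_{n,j}(s^n_{n-1,j}(a))\circ^n_ja=a=a\circ^n_j1^{n-1}_{n,j}(t^n_{n-1,j}(a))$),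 and such that: - interchange: $(a\circ^n_ib)\circ^n_j(c\circ^n_id)=(a\circ^n_jc)\circ^n_i(b\circ^n_jd)$ for $i\ne j$ whenever both sides are defined; - $1^n_{n+1,i}(a\circ^n_jb)=1^n_{n+1,i}(a)\circ^{n+1}_{j+1}1^n_{n+1,i}(b)$ if $1\le i\le j\le n$, and $=1^n_{n+1,i}(a)\circ^{n+1}_j1^n_{n+1,i}(b)$ if $1\le j<i\le n+1$; - $1^{n,\gamma}_{n+1,i}(a\circ^n_jb)=1^{n,\gamma}_{n+1,i}(a)\circ^{n+1}_{j+1}1^{n,\gamma}_{n+1,i}(b)$ if $1\le i<j\le n$, and $=1^{n,\gamma}_{n+1,i}(a)\circ^{n+1}_j1^{n,\gamma}_{n+1,i}(b)$ if $1\le j<i\le n$; - transport laws, for $1\le j\le n$: $1^{n,+}_{n+1,j}(a\circ^n_jb)=\bigl(1^{n,+}_{n+1,j}(a)\circ^{n+1}_j1^n_{n+1,j}(a)\bigr)\circ^{n+1}_{j+1}\bigl(1^n_{n+1,j+1}(a)\circ^{n+1}_j1^{n,+}_{n+1,j}(b)\bigr)$ and $1^{n,-}_{n+1,j}(a\circ^n_jb)=\bigl(1^{n,-}_{n+1,j}(a)\circ^{n+1}_j1^n_{n+1,j+1}(b)\bigr)\circ^{n+1}_{j+1}\bigl(1^n_{n+1,j}(b)\circ^{n+1}_j1^{n,-}_{n+1,j}(b)\bigr)$; - for $1\le i\le n$: $1^{n,+}_{n+1,i}(x)\circ^{n+1}_i1^{n,-}_{n+1,i}(x)=1^n_{n+1,i+1}(x)$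 and $1^{n,+}_{n+1,i}(x)\circ^{n+1}_{i+1}1^{n,-}_{n+1,i}(x)=1^n_{n+1,i}(x)$. **Cubical categorical stretchings.** An object of $\infty\text{-}\mathbb{C}\mathbb{E}\mathrm{tC}$ is a quintuple $(M,C,\pi,([-;-]^n_{n+1,j})_{n\ge0,1\le j\le n+1},([-;-]^{n,\gamma}_{n+1,j})_{n\ge1,1\le j\le n,\gamma\in\{-,+\}})$ with $M$ a cubical reflexive $\infty$-magma, $C$ a strict cubical $\infty$-category, $\pi:M\to C$ a morphism of $\infty\text{-}\mathbb{C}\mathbb{M}\mathrm{ag}_r$, and bracketing maps as follows. Put $\underline{M}_0=\{(\alpha,\beta)\in M_0\times M_0:\alpha=\beta\}$ and for $n\ge1$, $\underline{M}_n=\{(\alpha,\beta)\in M_n\times M_n:\pi_n(\alpha)=\pi_n(\beta)\}$, $\underline{M}^s_{n,j}=\{(\alpha,\beta)\in\underline{M}_n:s^n_{n-1,j}(\alpha)=s^n_{n-1,j}(\beta)\}$, $\underline{M}^t_{n,j}=\{(\alpha,\beta)\in\underline{M}_n:t^n_{n-1,j}(\alpha)=t^n_{n-1,j}(\beta)\}$. The brackets are maps $[-;-]^n_{n+1,j}:\underline{M}_n\to M_{n+1}$, $[-;-]^{n,-}_{n+1,j}:\underline{M}^s_{n,j}\to M_{n+1}$, $[-;-]^{n,+}_{n+1,j}:\underline{M}^t_{n,j}\to M_{n+1}$ satisfying (each equation includes the requirement that the brackets in it be defined; $r\in\{s,t\}$): - $r^{n+1}_{n,i}([\alpha;\beta]^n_{n+1,j})=[r^n_{n-1,i}(\alpha);r^n_{n-1,i}(\beta)]^{n-1}_{n,j-1}$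 if $1\le i<j\le n+1$; $=[r^n_{n-1,i-1}(\alpha);r^n_{n-1,i-1}(\beta)]^{n-1}_{n,j}$ if $1\le j<i\le n+1$; $s^{n+1}_{n,j}([\alpha;\beta]^n_{n+1,j})=\alpha$ and $t^{n+1}_{n,j}([\alpha;\beta]^n_{n+1,j})=\beta$; - $\pi_{n+1}([\alpha;\beta]^n_{n+1,j})=1^n_{n+1,j}(\pi_n(\alpha))=1^n_{n+1,j}(\pi_n(\beta))$, and $[\alpha;\alpha]^n_{n+1,j}=1^n_{n+1,j}(\alpha)$ for all $\alpha\in M_n$; - for $1\le j\le n$: $s^{n+1}_{n,j}([\alpha;\beta]^{n,-}_{n+1,j})=\alpha$, $s^{n+1}_{n,j+1}([\alpha;\beta]^{n,-}_{n+1,j})=\beta$, $t^{n+1}_{n,j}([\alpha;\beta]^{n,+}_{n+1,j})=\alpha$, $t^{n+1}_{n,j+1}([\alpha;\beta]^{n,+}_{n+1,j})=\beta$, $s^{n+1}_{n,j}([\alpha;\beta]^{n,+}_{n+1,j})=s^{n+1}_{n,j+1}([\alpha;\beta]^{n,+}_{n+1,j})=[s^n_{n-1,j}(\alpha);s^n_{n-1,j}(\beta)]^{n-1}_{n,j}$, $t^{n+1}_{n,j}([\alpha;\beta]^{n,-}_{n+1,j})=t^{n+1}_{n,j+1}([\alpha;\beta]^{n,-}_{n+1,j})=[t^n_{n-1,j}(\alpha);t^n_{n-1,j}(\beta)]^{n-1}_{n,j}$; - $r^{n+1}_{n,i}([\alpha;\beta]^{n,\gamma}_{n+1,j})=[r^n_{n-1,i}(\alpha);r^n_{n-1,i}(\beta)]^{n-1,\gamma}_{n,j-1}$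 if $1\le i<j\le n$; $=[r^n_{n-1,i-1}(\alpha);r^n_{n-1,i-1}(\beta)]^{n-1,\gamma}_{n,j}$ if $2\le j+1<i\le n+1$; - $\pi_{n+1}([\alpha;\beta]^{n,\gamma}_{n+1,j})=1^{n,\gamma}_{n+1,j}(\pi_n(\alpha))=1^{n,\gamma}_{n+1,j}(\pi_n(\beta))$, and $[\alpha;\alpha]^{n,\gamma}_{n+1,j}=1^{n,\gamma}_{n+1,j}(\alpha)$ for all $\alpha\in M_n$. A morphism from $(M,C,\pi,\dots)$ to $(M',C',\pi',\dots)$ is a pair $(m,c)$ of morphisms $m:M\to M'$, $c:C\to C'$ of $\infty\text{-}\mathbb{C}\mathbb{M}\mathrm{ag}_r$ with $\pi'm=c\pi$, such that $m_{n+1}([\alpha;\beta]^n_{n+1,j})=[m_n(\alpha);m_n(\beta)]^n_{n+1,j}$ and $m_{n+1}([\alpha;\beta]^{n,\gamma}_{n+1,j})=[m_n(\alpha);m_n(\beta)]^{n,\gamma}_{n+1,j}$ for all pairs in the respective domains. *)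

(* Defs.v *)
From mathcomp Require Import all_boot.
From mathcomp Require Import boolp.

Set Implicit Arguments.
Unset Strict Implicit.
Unset Printing Implicit Defensive.

(** Conventions.  Sets are types with Leibniz equality.  A direction
    [1 <= j <= n] is encoded by the ordinal [j - 1 : 'I_n]; all side conditions
    of the axioms only compare or shift directions, so they read the same.  An
    index such as [j - 1] is written as an ordinal [j'] with
    [j'.+1 = j :> nat], which determines it. *)

(** [Neg] stands for a source (resp. a connection [1^{n,-}]), and [Pos] for a
    target (resp. a connection [1^{n,+}]). *)
Variant side := Neg | Pos.

Definition opp (e : side) : side := if e is Neg then Pos else Neg.

(** * Cubical sets *)

Record cubical_set := CubicalSet {
  cell :> nat -> Type;
  face : side -> forall n, 'I_n.+1 -> cell n.+1 -> cell n;
  face_face : forall (r q : side) n (i j : 'I_n.+2) (i' j' : 'I_n.+1)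
      (x : cell n.+2),
    i < j -> i' = i :> nat -> j'.+1 = j :> nat ->
    face r i' (face q j x) = face q j' (face r i x)
}.

Arguments face {_} _ {n} _ _.
Notation src := (face Neg).
Notation tgt := (face Pos).

Record cubical_map (C D : cubical_set) := CubicalMap {
  cell_map :> forall n, C n -> D n;
  map_face : forall r n (i : 'I_n.+1) (x : C n.+1),
    cell_map (face r i x) = face r i (cell_map x)
}.

(** * Reflexive cubical sets *)

Record reflexive_cubical_set := ReflexiveCubicalSet {
  rcs_cs :> cubical_set;
  refl : forall n, 'I_n.+1 -> rcs_cs n -> rcs_cs n.+1;
  conn : side -> forall n, 'I_n.+1 -> rcs_cs n.+1 -> rcs_cs n.+2;

  refl_refl : forall n (i j : 'I_n.+1) (i' j' : 'I_n.+2) (x : rcs_cs n),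
    i <= j -> i' = i :> nat -> j' = j.+1 :> nat ->
    refl i' (refl j x) = refl j' (refl i x);

  face_refl_lt : forall r n (i j : 'I_n.+2) (i' j' : 'I_n.+1)
      (x : rcs_cs n.+1),
    i < j -> i' = i :> nat -> j'.+1 = j :> nat ->
    face r i (refl j x) = refl j' (face r i' x);
  face_refl_gt : forall r n (i j : 'I_n.+2) (i' j' : 'I_n.+1)
      (x : rcs_cs n.+1),
    j < i -> i'.+1 = i :> nat -> j' = j :> nat ->
    face r i (refl j x) = refl j' (face r i' x);
  face_refl_id : forall r n (j : 'I_n.+1) (x : rcs_cs n),
    face r j (refl j x) = x;

  conn_conn : forall g n (i j : 'I_n.+1) (i' j' : 'I_n.+2) (x : rcs_cs n.+1),
    i <= j -> i' = i :> nat -> j' = j.+1 :> nat ->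
    conn g i' (conn g j x) = conn g j' (conn g i x);

  conn_refl_lt : forall g n (i : 'I_n.+1) (i' j : 'I_n.+2) (j' : 'I_n.+3)
      (x : rcs_cs n.+1),
    i < j -> i' = i :> nat -> j' = j.+1 :> nat ->
    conn g i' (refl j x) = refl j' (conn g i x);
  conn_refl_gt : forall g n (i' : 'I_n.+1) (i j : 'I_n.+2) (j' : 'I_n.+3)
      (x : rcs_cs n.+1),
    j < i -> i'.+1 = i :> nat -> j' = j :> nat ->
    conn g i (refl j x) = refl j' (conn g i' x);
  conn_refl_id : forall g n (j : 'I_n.+1) (j' : 'I_n.+2) (x : rcs_cs n),
    j' = j :> nat ->
    conn g j (refl j x) = refl j' (refl j x);

  face_conn_lt : forall r g n (i : 'I_n.+3) (j i' : 'I_n.+2) (j' : 'I_n.+1)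
      (x : rcs_cs n.+2),
    i < j -> i' = i :> nat -> j'.+1 = j :> nat ->
    face r i (conn g j x) = conn g j' (face r i' x);
  face_conn_gt : forall r g n (i : 'I_n.+3) (j i' : 'I_n.+2) (j' : 'I_n.+1)
      (x : rcs_cs n.+2),
    j.+1 < i -> i'.+1 = i :> nat -> j' = j :> nat ->
    face r i (conn g j x) = conn g j' (face r i' x);

  face_conn_id : forall g n (j : 'I_n.+1) (i : 'I_n.+2) (x : rcs_cs n.+1),
    i = j :> nat \/ i = j.+1 :> nat ->
    face g i (conn g j x) = x;
  face_conn_opp : forall g n (j : 'I_n.+1) (i : 'I_n.+2) (x : rcs_cs n.+1),
    i = j :> nat \/ i = j.+1 :> nat ->
    face (opp g) i (conn g j x) = refl j (face (opp g) j x)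
}.

Arguments refl {_ n} _ _.
Arguments conn {_} _ {n} _ _.

(** * Cubical reflexive infinity-magmas *)

(** [eq_cmp cmp j a b c]: "[cmp j a b] is defined and equal to [c]". *)
Definition eq_cmp (C : cubical_set)
    (cmp : forall n (j : 'I_n.+1) (a b : C n.+1), tgt j a = src j b -> C n.+1)
    n (j : 'I_n.+1) (a b c : C n.+1) : Prop :=
  exists h : tgt j a = src j b, cmp n j a b h = c.

Record cubical_magma := CubicalMagma {
  mag_rcs :> reflexive_cubical_set;
  cmp : forall n (j : 'I_n.+1) (a b : mag_rcs n.+1),
    tgt j a = src j b -> mag_rcs n.+1;
  src_cmp : forall n (j : 'I_n.+1) (a b : mag_rcs n.+1)
      (h : tgt j a = src j b),
    src j (cmp h) = src j a;
  tgt_cmp : forall n (j : 'I_n.+1) (a b : mag_rcs n.+1)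
      (h : tgt j a = src j b),
    tgt j (cmp h) = tgt j b;
  face_cmp_lt : forall r n (i j : 'I_n.+2) (j' : 'I_n.+1)
      (a b : mag_rcs n.+2) (h : tgt j a = src j b),
    i < j -> j'.+1 = j :> nat ->
    eq_cmp cmp j' (face r i a) (face r i b) (face r i (cmp h));
  face_cmp_gt : forall r n (i j : 'I_n.+2) (j' : 'I_n.+1)
      (a b : mag_rcs n.+2) (h : tgt j a = src j b),
    j < i -> j' = j :> nat ->
    eq_cmp cmp j' (face r i a) (face r i b) (face r i (cmp h))
}.

Arguments cmp {_ n} j {a b} h.

Definition is_cmp (M : cubical_magma) n (j : 'I_n.+1) (a b c : M n.+1) : Prop :=
  eq_cmp (@cmp M) j a b c.

Record magma_map (M N : cubical_magma) := MagmaMap {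
  mm_map :> cubical_map M N;
  map_refl : forall n (j : 'I_n.+1) (x : M n),
    mm_map _ (refl j x) = refl j (mm_map _ x);
  map_conn : forall g n (j : 'I_n.+1) (x : M n.+1),
    mm_map _ (conn g j x) = conn g j (mm_map _ x);
  map_cmp : forall n (j : 'I_n.+1) (a b c : M n.+1),
    is_cmp j a b c -> is_cmp j (mm_map _ a) (mm_map _ b) (mm_map _ c)
}.

(** * Strict cubical infinity-categories *)

Record strict_cubical_category := StrictCubicalCategory {
  scc_mag :> cubical_magma;

  cmpA : forall n (j : 'I_n.+1) (a b c ab bc : scc_mag n.+1),
    is_cmp j a b ab -> is_cmp j b c bc ->
    exists abc, is_cmp j ab c abc /\ is_cmp j a bc abc;
  cmp_refl_l : forall n (j : 'I_n.+1) (a : scc_mag n.+1),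
    is_cmp j (refl j (src j a)) a a;
  cmp_refl_r : forall n (j : 'I_n.+1) (a : scc_mag n.+1),
    is_cmp j a (refl j (tgt j a)) a;

  interchange : forall n (i j : 'I_n.+1)
      (a b c d ab cd ac bd x y : scc_mag n.+1),
    i <> j ->
    is_cmp i a b ab -> is_cmp i c d cd -> is_cmp j ab cd x ->
    is_cmp j a c ac -> is_cmp j b d bd -> is_cmp i ac bd y ->
    x = y;

  refl_cmp_le : forall n (i j' : 'I_n.+2) (j : 'I_n.+1)
      (a b c : scc_mag n.+1),
    i <= j -> j' = j.+1 :> nat ->
    is_cmp j a b c -> is_cmp j' (refl i a) (refl i b) (refl i c);
  refl_cmp_gt : forall n (i j' : 'I_n.+2) (j : 'I_n.+1)
      (a b c : scc_mag n.+1),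
    j < i -> j' = j :> nat ->
    is_cmp j a b c -> is_cmp j' (refl i a) (refl i b) (refl i c);

  conn_cmp_lt : forall g n (i j : 'I_n.+1) (j' : 'I_n.+2)
      (a b c : scc_mag n.+1),
    i < j -> j' = j.+1 :> nat ->
    is_cmp j a b c -> is_cmp j' (conn g i a) (conn g i b) (conn g i c);
  conn_cmp_gt : forall g n (i j : 'I_n.+1) (j' : 'I_n.+2)
      (a b c : scc_mag n.+1),
    j < i -> j' = j :> nat ->
    is_cmp j a b c -> is_cmp j' (conn g i a) (conn g i b) (conn g i c);

  transport_pos : forall n (j : 'I_n.+1) (j0 j1 : 'I_n.+2)
      (a b c : scc_mag n.+1),
    j0 = j :> nat -> j1 = j.+1 :> nat -> is_cmp j a b c ->
    exists u v, [/\ is_cmp j0 (conn Pos j a) (refl j0 a) u,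
                    is_cmp j0 (refl j1 a) (conn Pos j b) v
                  & is_cmp j1 u v (conn Pos j c)];
  transport_neg : forall n (j : 'I_n.+1) (j0 j1 : 'I_n.+2)
      (a b c : scc_mag n.+1),
    j0 = j :> nat -> j1 = j.+1 :> nat -> is_cmp j a b c ->
    exists u v, [/\ is_cmp j0 (conn Neg j a) (refl j1 b) u,
                    is_cmp j0 (refl j0 b) (conn Neg j b) v
                  & is_cmp j1 u v (conn Neg j c)];

  conn_cmp_conn0 : forall n (i : 'I_n.+1) (i0 i1 : 'I_n.+2)
      (x : scc_mag n.+1),
    i0 = i :> nat -> i1 = i.+1 :> nat ->
    is_cmp i0 (conn Pos i x) (conn Neg i x) (refl i1 x);
  conn_cmp_conn1 : forall n (i : 'I_n.+1) (i0 i1 : 'I_n.+2)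
      (x : scc_mag n.+1),
    i0 = i :> nat -> i1 = i.+1 :> nat ->
    is_cmp i1 (conn Pos i x) (conn Neg i x) (refl i0 x)
}.

(** * Cubical categorical stretchings *)

Section BracketDomains.
Variables (M : cubical_magma) (C : strict_cubical_category).
Variable p : magma_map M C.

Definition par n : M n -> M n -> Prop :=
  match n with
  | 0 => fun a b => a = b
  | m.+1 => fun a b => p m.+1 a = p m.+1 b
  end.

(** [M^s_{n+1,j}] for [Neg], [M^t_{n+1,j}] for [Pos]. *)
Definition par_at (g : side) n (j : 'I_n.+1) (a b : M n.+1) : Prop :=
  par a b /\ face g j a = face g j b.

(** "The bracket is defined and equal to [c]". *)
Definition eq_br
    (br : forall n (j : 'I_n.+1) (a b : M n), par a b -> M n.+1)
    n (j : 'I_n.+1) (a b : M n) (c : M n.+1) : Prop :=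
  exists h : par a b, br n j a b h = c.

Definition eq_brc
    (brc : forall g n (j : 'I_n.+1) (a b : M n.+1), par_at g j a b -> M n.+2)
    g n (j : 'I_n.+1) (a b : M n.+1) (c : M n.+2) : Prop :=
  exists h : par_at g j a b, brc g n j a b h = c.

End BracketDomains.

Record stretching := Stretching {
  st_mag : cubical_magma;
  st_cat : strict_cubical_category;
  st_proj : magma_map st_mag st_cat;
  br : forall n (j : 'I_n.+1) (a b : st_mag n),
    par st_proj a b -> st_mag n.+1;
  brc : forall g n (j : 'I_n.+1) (a b : st_mag n.+1),
    par_at st_proj g j a b -> st_mag n.+2;

  (* [eq_br] asserts that the right-hand bracket is defined; for [n = 0] this
     makes the faces of [a] and [b] coincide as soon as [a] and [b] have the
     same projection. *)
  face_br_lt : forall r n (i j : 'I_n.+2) (i' j' : 'I_n.+1)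
      (a b : st_mag n.+1) (h : par st_proj a b),
    i < j -> i' = i :> nat -> j'.+1 = j :> nat ->
    eq_br br j' (face r i' a) (face r i' b) (face r i (br j h));
  face_br_gt : forall r n (i j : 'I_n.+2) (i' j' : 'I_n.+1)
      (a b : st_mag n.+1) (h : par st_proj a b),
    j < i -> i'.+1 = i :> nat -> j' = j :> nat ->
    eq_br br j' (face r i' a) (face r i' b) (face r i (br j h));
  src_br : forall n (j : 'I_n.+1) (a b : st_mag n) (h : par st_proj a b),
    src j (br j h) = a;
  tgt_br : forall n (j : 'I_n.+1) (a b : st_mag n) (h : par st_proj a b),
    tgt j (br j h) = b;
  proj_br : forall n (j : 'I_n.+1) (a b : st_mag n) (h : par st_proj a b),
    st_proj _ (br j h) = refl j (st_proj _ a) /\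
    st_proj _ (br j h) = refl j (st_proj _ b);
  br_refl : forall n (j : 'I_n.+1) (a : st_mag n),
    eq_br br j a a (refl j a);

  face_brc_fst : forall g n (j : 'I_n.+1) (j0 : 'I_n.+2) (a b : st_mag n.+1)
      (h : par_at st_proj g j a b),
    j0 = j :> nat -> face g j0 (brc h) = a;
  face_brc_snd : forall g n (j : 'I_n.+1) (j1 : 'I_n.+2) (a b : st_mag n.+1)
      (h : par_at st_proj g j a b),
    j1 = j.+1 :> nat -> face g j1 (brc h) = b;
  face_brc_opp : forall g n (j : 'I_n.+1) (i : 'I_n.+2) (a b : st_mag n.+1)
      (h : par_at st_proj g j a b),
    i = j :> nat \/ i = j.+1 :> nat ->
    eq_br br j (face (opp g) j a) (face (opp g) j b) (face (opp g) i (brc h));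
  face_brc_lt : forall r g n (i : 'I_n.+3) (j i' : 'I_n.+2) (j' : 'I_n.+1)
      (a b : st_mag n.+2) (h : par_at st_proj g j a b),
    i < j -> i' = i :> nat -> j'.+1 = j :> nat ->
    eq_brc brc g j' (face r i' a) (face r i' b) (face r i (brc h));
  face_brc_gt : forall r g n (i : 'I_n.+3) (j i' : 'I_n.+2) (j' : 'I_n.+1)
      (a b : st_mag n.+2) (h : par_at st_proj g j a b),
    j.+1 < i -> i'.+1 = i :> nat -> j' = j :> nat ->
    eq_brc brc g j' (face r i' a) (face r i' b) (face r i (brc h));
  proj_brc : forall g n (j : 'I_n.+1) (a b : st_mag n.+1)
      (h : par_at st_proj g j a b),
    st_proj _ (brc h) = conn g j (st_proj _ a) /\
    st_proj _ (brc h) = conn g j (st_proj _ b);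
  brc_refl : forall g n (j : 'I_n.+1) (a : st_mag n.+1),
    eq_brc brc g j a a (conn g j a)
}.

Arguments br {_ n} j {a b} h.
Arguments brc {_} g {n} j {a b} h.

Definition is_br (S : stretching) n (j : 'I_n.+1) (a b : st_mag S n)
    (c : st_mag S n.+1) : Prop :=
  eq_br (@br S) j a b c.

Definition is_brc (S : stretching) g n (j : 'I_n.+1) (a b : st_mag S n.+1)
    (c : st_mag S n.+2) : Prop :=
  eq_brc (@brc S) g j a b c.

Record stretching_map (S T : stretching) := StretchingMap {
  sm_mag : magma_map (st_mag S) (st_mag T);
  sm_cat : magma_map (st_cat S) (st_cat T);
  sm_proj : forall n (x : st_mag S n),
    st_proj T n (sm_mag n x) = sm_cat n (st_proj S n x);
  map_br : forall n (j : 'I_n.+1) (a b : st_mag S n) c,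
    is_br j a b c -> is_br j (sm_mag n a) (sm_mag n b) (sm_mag n.+1 c);
  map_brc : forall g n (j : 'I_n.+1) (a b : st_mag S n.+1) c,
    is_brc g j a b c ->
    is_brc g j (sm_mag n.+1 a) (sm_mag n.+1 b) (sm_mag n.+2 c)
}.

(** * Categories, adjunctions, monads *)

Record category := Category {
  ob :> Type;
  hom : ob -> ob -> Type;
  idm : forall X, hom X X;
  compm : forall X Y Z, hom Y Z -> hom X Y -> hom X Z;
  compm1 : forall X Y (f : hom X Y), compm f (idm X) = f;
  comp1m : forall X Y (f : hom X Y), compm (idm Y) f = f;
  compmA : forall X Y Z T (h : hom Z T) (g : hom Y Z) (f : hom X Y),
    compm h (compm g f) = compm (compm h g) f
}.

Arguments hom {c} X Y.
Arguments idm {c} X.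
Arguments compm {c X Y Z} g f.
Reserved Notation "g \om f" (at level 50, left associativity).
Notation "g \om f" := (compm g f).

Record functor (C D : category) := Functor {
  fob :> C -> D;
  fmap : forall X Y, hom X Y -> hom (fob X) (fob Y);
  fmap1 : forall X, fmap (idm X) = idm (fob X);
  fmapM : forall X Y Z (g : hom Y Z) (f : hom X Y),
    fmap (g \om f) = fmap g \om fmap f
}.

Arguments fmap {C D} _ {X Y} _.

Definition functor_id (C : category) : functor C C :=
  @Functor C C id (fun _ _ f => f) (fun _ => erefl) (fun _ _ _ _ _ => erefl).

Section FunctorComp.
Variables (C D E : category) (G : functor D E) (F : functor C D).

Let m X Y (f : @hom C X Y) : hom (G (F X)) (G (F Y)) := fmap G (fmap F f).

Lemma functor_comp1 X : m (idm X) = idm (G (F X)).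
Proof. by rewrite /m !fmap1. Qed.

Lemma functor_compM X Y Z (g : @hom C Y Z) (f : @hom C X Y) :
  m (g \om f) = m g \om m f.
Proof. by rewrite /m !fmapM. Qed.

Definition functor_comp : functor C E := Functor functor_comp1 functor_compM.

End FunctorComp.

Reserved Notation "G \oF F" (at level 50, left associativity).
Notation "G \oF F" := (functor_comp G F).

Record nat_trans (C D : category) (F G : functor C D) := NatTrans {
  nt_app :> forall X, hom (F X) (G X);
  nt_natural : forall X Y (f : hom X Y),
    nt_app Y \om fmap F f = fmap G f \om nt_app X
}.

(** [F] is left adjoint to [U] with unit [eta] and counit [eps]. *)
Definition is_adjunction (C D : category) (F : functor C D) (U : functor D C)
    (eta : nat_trans (functor_id C) (U \oF F))
    (eps : nat_trans (F \oF U) (functor_id D)) : Prop :=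
  (forall X, eps (F X) \om fmap F (eta X) = idm (F X)) /\
  (forall A, fmap U (eps A) \om eta (U A) = idm (U A)).

Definition is_monad (C : category) (W : functor C C)
    (eta : nat_trans (functor_id C) W) (nu : nat_trans (W \oF W) W) : Prop :=
  [/\ forall X, nu X \om fmap W (nu X) = nu X \om nu (W X),
      forall X, nu X \om fmap W (eta X) = idm (W X)
    & forall X, nu X \om eta (W X) = idm (W X)].

(** * The category of cubical sets *)

Lemma cubical_mapP (C D : cubical_set) (f g : cubical_map C D) :
  (forall n (x : C n), f n x = g n x) -> f = g.
Proof.
case: f g => [f Hf] [g Hg] /= fg.
have E : f = g by do 2 (apply: functional_extensionality_dep => ?); exact: fg.
by case: g / E Hg {fg} => Hg; congr CubicalMap; apply: Prop_irrelevance.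
Qed.

Definition cubical_id (C : cubical_set) : cubical_map C C :=
  @CubicalMap C C (fun _ x => x) (fun _ _ _ _ => erefl).

Section CubicalComp.
Variables (C D E : cubical_set) (g : cubical_map D E) (f : cubical_map C D).

Lemma cubical_comp_face r n (i : 'I_n.+1) (x : C n.+1) :
  g n (f n (face r i x)) = face r i (g _ (f _ x)).
Proof. by rewrite !map_face. Qed.

Definition cubical_comp : cubical_map C E :=
  @CubicalMap C E (fun n x => g n (f n x)) cubical_comp_face.

End CubicalComp.

Lemma cubical_comp1 C D (f : cubical_map C D) :
  cubical_comp f (cubical_id C) = f.
Proof. exact: cubical_mapP. Qed.

Lemma cubical_1comp C D (f : cubical_map C D) :
  cubical_comp (cubical_id D) f = f.
Proof. exact: cubical_mapP. Qed.

Lemma cubical_compA B C D E (h : cubical_map D E) (g : cubical_map C D)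
    (f : cubical_map B C) :
  cubical_comp h (cubical_comp g f) = cubical_comp (cubical_comp h g) f.
Proof. exact: cubical_mapP. Qed.

Definition CSets : category :=
  Category cubical_comp1 cubical_1comp cubical_compA.

(** * The category of stretchings *)

Lemma magma_mapP (M N : cubical_magma) (f g : magma_map M N) :
  (forall n (x : M n), f n x = g n x) -> f = g.
Proof.
case: f g => [f f1 f2 f3] [g g1 g2 g3] /= fg.
have E : f = g by exact: cubical_mapP.
by case: g / E g1 g2 g3 {fg} => *; congr MagmaMap; apply: Prop_irrelevance.
Qed.

Definition magma_id (M : cubical_magma) : magma_map M M :=
  @MagmaMap M M (cubical_id M) (fun _ _ _ => erefl) (fun _ _ _ _ => erefl)
    (fun _ _ _ _ _ h => h).

Section MagmaComp.
Variables (M N P : cubical_magma) (g : magma_map N P) (f : magma_map M N).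

Lemma magma_comp_refl n (j : 'I_n.+1) (x : M n) :
  cubical_comp g f _ (refl j x) = refl j (cubical_comp g f _ x).
Proof. by rewrite /= !map_refl. Qed.

Lemma magma_comp_conn e n (j : 'I_n.+1) (x : M n.+1) :
  cubical_comp g f _ (conn e j x) = conn e j (cubical_comp g f _ x).
Proof. by rewrite /= !map_conn. Qed.

Lemma magma_comp_cmp n (j : 'I_n.+1) (a b c : M n.+1) :
  is_cmp j a b c ->
  is_cmp j (cubical_comp g f _ a) (cubical_comp g f _ b)
    (cubical_comp g f _ c).
Proof. by move=> h /=; apply/map_cmp/map_cmp. Qed.

Definition magma_comp : magma_map M P :=
  MagmaMap magma_comp_refl magma_comp_conn magma_comp_cmp.

End MagmaComp.

Lemma stretching_mapP (S T : stretching) (f g : stretching_map S T) :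
  (forall n x, sm_mag f n x = sm_mag g n x) ->
  (forall n x, sm_cat f n x = sm_cat g n x) -> f = g.
Proof.
case: f g => [f f' f1 f2 f3] [g g' g1 g2 g3] /= fg fg'.
have E : f = g by exact: magma_mapP.
have E' : f' = g' by exact: magma_mapP.
case: g / E g1 g2 g3 {fg}; case: g' / E' {fg'} => *.
by congr StretchingMap; apply: Prop_irrelevance.
Qed.

Definition stretching_id (S : stretching) : stretching_map S S :=
  @StretchingMap S S (magma_id _) (magma_id _) (fun _ _ => erefl)
    (fun _ _ _ _ _ h => h) (fun _ _ _ _ _ _ h => h).

Section StretchingComp.
Variables (S T V : stretching) (g : stretching_map T V).
Variable f : stretching_map S T.

Let m := magma_comp (sm_mag g) (sm_mag f).
Let c := magma_comp (sm_cat g) (sm_cat f).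

Lemma stretching_comp_proj n (x : st_mag S n) :
  st_proj V n (m n x) = c n (st_proj S n x).
Proof. by rewrite /= !sm_proj. Qed.

Lemma stretching_comp_br n (j : 'I_n.+1) (a b : st_mag S n) d :
  is_br j a b d -> is_br j (m n a) (m n b) (m n.+1 d).
Proof. by move=> h; apply/map_br/map_br. Qed.

Lemma stretching_comp_brc e n (j : 'I_n.+1) (a b : st_mag S n.+1) d :
  is_brc e j a b d -> is_brc e j (m n.+1 a) (m n.+1 b) (m n.+2 d).
Proof. by move=> h; apply/map_brc/map_brc. Qed.

Definition stretching_comp : stretching_map S V :=
  StretchingMap stretching_comp_proj stretching_comp_br stretching_comp_brc.

End StretchingComp.

Lemma stretching_comp1 S T (f : stretching_map S T) :
  stretching_comp f (stretching_id S) = f.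
Proof. exact: stretching_mapP. Qed.

Lemma stretching_1comp S T (f : stretching_map S T) :
  stretching_comp (stretching_id T) f = f.
Proof. exact: stretching_mapP. Qed.

Lemma stretching_compA R S T V (h : stretching_map T V)
    (g : stretching_map S T) (f : stretching_map R S) :
  stretching_comp h (stretching_comp g f)
  = stretching_comp (stretching_comp h g) f.
Proof. exact: stretching_mapP. Qed.

Definition CEtC : category :=
  Category stretching_comp1 stretching_1comp stretching_compA.

Definition forget : functor CEtC CSets :=
  @Functor CEtC CSets (fun S => st_mag S : cubical_set)
    (fun S T f => sm_mag f : cubical_map (st_mag S) (st_mag T))
    (fun _ => erefl) (fun _ _ _ _ _ => erefl).

(* Main.v *)
From mathcomp Require Import all_boot.
From mathcomp Require Import boolp.
Require Import Defs.

Set Implicit Arguments.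
Unset Strict Implicit.
Unset Printing Implicit Defensive.

(** A stretching is a model of an essentially algebraic theory: finitary
    operations, some of them partial, whose domains are given by equations and
    whose axioms are Horn clauses.  Hence a family of subsets of the cells of
    a product of stretchings, once closed under the operations wherever these
    are defined in every factor, is again a stretching
    ([subproduct_stretching]): an equation holds in it as soon as it holds in
    each factor, and an operation is defined in it exactly when it is defined
    in each factor.

    The free stretching on a cubical set [X] is therefore the part generated by
    [X] of the product of all the stretchings [S] with a map [X -> U S].  This
    product is indexed by a class too large to form it, but its generated part
    is small: every cell of it is named by a formal term over [X], of which
    there is only a set.  So a cell is taken to be an equivalence class of
    terms that have a value in every [S], two terms being equivalent when their
    values agree in every [S] (section [Fibres] and [free_cell]).  Evaluation
    in [S] is then a morphism of stretchings by construction
    ([free_eval]), and it is the only one that extends [X -> U S], by induction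
    on terms ([free_map_eval]).  This is the universal property
    [free_universal], and universal arrows assemble into a left adjoint, whose
    adjunction induces the monad ([universal_adjunction_monad]). *)

(** * From universal arrows to adjunctions and monads *)

Section UniversalArrows.
Variables (C D : category) (U : functor D C).
Variables (F0 : C -> D) (unit0 : forall X : C, hom X (U (F0 X))).
Hypothesis univ : forall (X : C) (A : D) (f : hom X (U A)),
  exists! g : hom (F0 X) A, fmap U g \om unit0 X = f.

Definition transpose X A (f : hom X (U A)) : hom (F0 X) A :=
  sval (cid (univ f)).

Lemma transposeE X A (f : hom X (U A)) : fmap U (transpose f) \om unit0 X = f.
Proof. by rewrite /transpose; case: cid => g /= []. Qed.

Lemma universal_inj X A (g h : hom (F0 X) A) :
  fmap U g \om unit0 X = fmap U h \om unit0 X -> g = h.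
Proof.
have [k [_ kP]] := univ (fmap U h \om unit0 X).
by move=> gh; rewrite -(kP g gh) -(kP h erefl).
Qed.

Let lift X Y (f : hom X Y) : hom (F0 X) (F0 Y) := transpose (unit0 Y \om f).

Let liftE X Y (f : hom X Y) : fmap U (lift f) \om unit0 X = unit0 Y \om f.
Proof. exact: transposeE. Qed.

Lemma lift1 X : lift (idm X) = idm (F0 X).
Proof. by apply: universal_inj; rewrite liftE fmap1 compm1 comp1m. Qed.

Lemma liftM X Y Z (g : hom Y Z) (f : hom X Y) :
  lift (g \om f) = lift g \om lift f.
Proof.
by apply: universal_inj; rewrite liftE fmapM -compmA liftE !compmA liftE.
Qed.

Definition left_adjoint : functor C D := Functor lift1 liftM.

Lemma unit_natural X Y (f : hom X Y) :
  unit0 Y \om fmap (functor_id C) f = fmap (U \oF left_adjoint) f \om unit0 X.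
Proof. by rewrite /= liftE. Qed.

Definition adj_unit : nat_trans (functor_id C) (U \oF left_adjoint) :=
  @NatTrans _ _ (functor_id C) (U \oF left_adjoint) unit0 unit_natural.

Let counit0 A : hom (F0 (U A)) A := transpose (idm (U A)).

Lemma counit_natural A B (g : hom A B) :
  counit0 B \om fmap (left_adjoint \oF U) g
  = fmap (functor_id D) g \om counit0 A.
Proof.
apply: universal_inj; rewrite /= !fmapM -!compmA liftE transposeE.
by rewrite compmA transposeE comp1m compm1.
Qed.

Definition adj_counit : nat_trans (left_adjoint \oF U) (functor_id D) :=
  @NatTrans _ _ (left_adjoint \oF U) (functor_id D) counit0 counit_natural.

Lemma universal_adjunction : is_adjunction adj_unit adj_counit.
Proof.
split=> [X|A] /=; last exact: transposeE.
apply: universal_inj; rewrite fmapM -compmA liftE.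
by rewrite compmA transposeE fmap1.
Qed.

End UniversalArrows.

Section AdjunctionMonad.
Variables (C D : category) (F : functor C D) (U : functor D C).
Variables (eta : nat_trans (functor_id C) (U \oF F)).
Variables (eps : nat_trans (F \oF U) (functor_id D)).

Let mul0 X : hom (((U \oF F) \oF (U \oF F)) X) ((U \oF F) X) :=
  fmap U (eps (F X)).

Lemma monad_mul_natural X Y (f : hom X Y) :
  mul0 Y \om fmap ((U \oF F) \oF (U \oF F)) f = fmap (U \oF F) f \om mul0 X.
Proof. by rewrite /= -!fmapM (nt_natural eps (fmap F f)). Qed.

Definition monad_mul : nat_trans ((U \oF F) \oF (U \oF F)) (U \oF F) :=
  @NatTrans _ _ ((U \oF F) \oF (U \oF F)) (U \oF F) mul0 monad_mul_natural.

Lemma adjunction_monad : is_adjunction eta eps -> is_monad eta monad_mul.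
Proof.
case=> [triF triU]; split=> X /=.
- by rewrite -!fmapM (nt_natural eps (eps (F X))).
- by rewrite -!fmapM triF fmap1.
- exact: triU.
Qed.

End AdjunctionMonad.

Lemma universal_adjunction_monad (C D : category) (U : functor D C)
    (F0 : C -> D) (unit0 : forall X : C, hom X (U (F0 X))) :
  (forall (X : C) (A : D) (f : hom X (U A)),
    exists! g : hom (F0 X) A, fmap U g \om unit0 X = f) ->
  exists (F : functor C D) (eta : nat_trans (functor_id C) (U \oF F))
         (eps : nat_trans (F \oF U) (functor_id D)),
    is_adjunction eta eps /\
    exists nu : nat_trans ((U \oF F) \oF (U \oF F)) (U \oF F),
      (forall X, nu X = fmap U (eps (F X))) /\ is_monad eta nu.
Proof.
move=> univ; have adj := universal_adjunction univ.
exists (left_adjoint univ), (adj_unit univ), (adj_counit univ); split=> //.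
by exists (monad_mul (adj_counit univ)); split=> //; apply: adjunction_monad.
Qed.

(** * Subobjects of products *)

Lemma is_cmp_fun (M : cubical_magma) n (j : 'I_n.+1) (a b c d : M n.+1) :
  is_cmp j a b c -> is_cmp j a b d -> c = d.
Proof. by case=> [h <-] [h' <-]; congr cmp; apply: Prop_irrelevance. Qed.

Lemma is_br_fun (S : stretching) n (j : 'I_n.+1) (a b : st_mag S n) c d :
  is_br j a b c -> is_br j a b d -> c = d.
Proof. by case=> [h <-] [h' <-]; congr br; apply: Prop_irrelevance. Qed.

Lemma is_brc_fun (S : stretching) g n (j : 'I_n.+1) (a b : st_mag S n.+1) c d :
  is_brc g j a b c -> is_brc g j a b d -> c = d.
Proof. by case=> [h <-] [h' <-]; congr brc; apply: Prop_irrelevance. Qed.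

Section Subproducts.
Variable K : Type.

(** A family of subsets of the product of the [M k], closed under all
    operations.  The cells form a type of their own, with jointly injective
    coordinates, because the product itself may live in too large a universe
    when [K] is large. *)
Record subproduct (M : K -> cubical_magma) := Subproduct {
  sp_cell :> nat -> Type;
  sp_val : forall k n, sp_cell n -> M k n;
  sp_inj : forall n (x y : sp_cell n),
    (forall k, sp_val k x = sp_val k y) -> x = y;
  sp_face : forall r n (i : 'I_n.+1) (x : sp_cell n.+1),
    exists y, forall k, sp_val k y = face r i (sp_val k x);
  sp_refl : forall n (i : 'I_n.+1) (x : sp_cell n),
    exists y, forall k, sp_val k y = refl i (sp_val k x);
  sp_conn : forall g n (i : 'I_n.+1) (x : sp_cell n.+1),
    exists y, forall k, sp_val k y = conn g i (sp_val k x);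
  sp_cmp : forall n (j : 'I_n.+1) (a b : sp_cell n.+1),
    (forall k, tgt j (sp_val k a) = src j (sp_val k b)) ->
    exists c, forall k, is_cmp j (sp_val k a) (sp_val k b) (sp_val k c)
}.

(** The operations are forced, since [sp_inj] makes the cells provided by the
    closure conditions unique; every axiom is then checked coordinatewise. *)
Section Magma.
Variables (M : K -> cubical_magma) (Q : subproduct M).
Local Notation "x \at k" := (sp_val k x) (at level 30).

Let fc r n (i : 'I_n.+1) (x : Q n.+1) : Q n := sval (cid (sp_face r i x)).
Let fcE r n (i : 'I_n.+1) (x : Q n.+1) k : fc r i x \at k = face r i (x \at k).
Proof. exact: (svalP (cid (sp_face r i x))). Qed.

Let rf n (i : 'I_n.+1) (x : Q n) : Q n.+1 := sval (cid (sp_refl i x)).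
Let rfE n (i : 'I_n.+1) (x : Q n) k : rf i x \at k = refl i (x \at k).
Proof. exact: (svalP (cid (sp_refl i x))). Qed.

Let cn g n (i : 'I_n.+1) (x : Q n.+1) : Q n.+2 := sval (cid (sp_conn g i x)).
Let cnE g n (i : 'I_n.+1) (x : Q n.+1) k : cn g i x \at k = conn g i (x \at k).
Proof. exact: (svalP (cid (sp_conn g i x))). Qed.

Definition subproduct_cubical_set : cubical_set.
Proof.
refine (@CubicalSet Q fc _).
move=> r q n i j i' j' x *; apply: sp_inj => k.
by rewrite !fcE; apply: face_face.
Defined.

Definition subproduct_reflexive : reflexive_cubical_set.
Proof.
refine (@ReflexiveCubicalSet subproduct_cubical_set rf cn
  _ _ _ _ _ _ _ _ _ _ _ _).
- move=> *; apply: sp_inj => k; rewrite /= !rfE; exact: refl_refl.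
- move=> *; apply: sp_inj => k; rewrite /= !(fcE, rfE); exact: face_refl_lt.
- move=> *; apply: sp_inj => k; rewrite /= !(fcE, rfE); exact: face_refl_gt.
- move=> *; apply: sp_inj => k; rewrite /= !(fcE, rfE); exact: face_refl_id.
- move=> *; apply: sp_inj => k; rewrite /= !cnE; exact: conn_conn.
- move=> *; apply: sp_inj => k; rewrite /= !(cnE, rfE); exact: conn_refl_lt.
- move=> *; apply: sp_inj => k; rewrite /= !(cnE, rfE); exact: conn_refl_gt.
- move=> *; apply: sp_inj => k; rewrite /= !(cnE, rfE); exact: conn_refl_id.
- move=> *; apply: sp_inj => k; rewrite /= !(fcE, cnE); exact: face_conn_lt.
- move=> *; apply: sp_inj => k; rewrite /= !(fcE, cnE); exact: face_conn_gt.
- move=> *; apply: sp_inj => k; rewrite /= !(fcE, cnE); exact: face_conn_id.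
- move=> *; apply: sp_inj => k; rewrite /= !(fcE, cnE, rfE).
  exact: face_conn_opp.
Defined.

Let composable n (j : 'I_n.+1) (a b : Q n.+1) :
  fc Pos j a = fc Neg j b -> forall k, tgt j (a \at k) = src j (b \at k).
Proof. by move=> h k; rewrite -!fcE h. Qed.

Let cp n (j : 'I_n.+1) (a b : Q n.+1) (h : fc Pos j a = fc Neg j b) : Q n.+1 :=
  sval (cid (sp_cmp (composable h))).
Let cpE n (j : 'I_n.+1) (a b : Q n.+1) (h : fc Pos j a = fc Neg j b) k :
  is_cmp j (a \at k) (b \at k) (cp h \at k).
Proof. exact: (svalP (cid (sp_cmp (composable h)))). Qed.

Let cpP n (j : 'I_n.+1) (a b c : Q n.+1) :
  @eq_cmp subproduct_cubical_set cp n j a b c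
  <-> forall k, is_cmp j (a \at k) (b \at k) (c \at k).
Proof.
split=> [[h <-] k|abc]; first exact: cpE.
have h : fc Pos j a = fc Neg j b.
  by apply: sp_inj => k; rewrite !fcE; case: (abc k).
by exists h; apply: sp_inj => k; apply: is_cmp_fun (abc k); apply: cpE.
Qed.

Definition subproduct_magma : cubical_magma.
Proof.
refine (@CubicalMagma subproduct_reflexive cp _ _ _ _).
- move=> n j a b h; apply: sp_inj => k; rewrite /= !fcE.
  by have [h' <-] := cpE h k; apply: src_cmp.
- move=> n j a b h; apply: sp_inj => k; rewrite /= !fcE.
  by have [h' <-] := cpE h k; apply: tgt_cmp.
- move=> r n i j j' a b h *; apply/cpP => k; rewrite /= !fcE.
  by have [h' <-] := cpE h k; apply: face_cmp_lt.
- move=> r n i j j' a b h *; apply/cpP => k; rewrite /= !fcE.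
  by have [h' <-] := cpE h k; apply: face_cmp_gt.
Defined.

Definition subproduct_proj k : magma_map subproduct_magma (M k).
Proof.
pose f : cubical_map subproduct_magma (M k) :=
  @CubicalMap subproduct_magma (M k) (fun n x => x \at k)
    (fun r n i x => fcE r i x k).
refine (@MagmaMap _ _ f _ _ _) => /=.
- by move=> n j x; apply: rfE.
- by move=> g n j x; apply: cnE.
- by move=> n j a b c /cpP.
Defined.

Lemma subproduct_cmpP n (j : 'I_n.+1) (a b c : subproduct_magma n.+1) :
  is_cmp j a b c <-> forall k, is_cmp j (subproduct_proj k n.+1 a)
    (subproduct_proj k n.+1 b) (subproduct_proj k n.+1 c).
Proof. exact: cpP. Qed.

Lemma subproduct_eq n (x y : subproduct_magma n) :
  (forall k, subproduct_proj k n x = subproduct_proj k n y) -> x = y.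
Proof. exact: sp_inj. Qed.

(** In the axioms that assert the existence of a composite, the coordinates
    only provide one composite in each factor; being composable is what has to
    be transferred. *)
Lemma subproduct_cmp_ex n (j : 'I_n.+1) (a b : subproduct_magma n.+1) :
  (forall k, exists c,
    is_cmp j (subproduct_proj k n.+1 a) (subproduct_proj k n.+1 b) c) ->
  exists c, is_cmp j a b c.
Proof.
move=> ab; have [|c cP] := @sp_cmp _ Q n j a b.
  by move=> k; have [c []] := ab k.
by exists c; apply/subproduct_cmpP.
Qed.

End Magma.

Section StrictCategory.
Variables (C : K -> strict_cubical_category).
Variable Q : subproduct (fun k => C k).

Local Notation P := (subproduct_magma Q).
Local Notation pr := (subproduct_proj Q).

Definition subproduct_category : strict_cubical_category.
Proof.
refine (@StrictCubicalCategory P _ _ _ _ _ _ _ _ _ _ _ _).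
- move=> n j a b c ab bc /subproduct_cmpP hab /subproduct_cmpP hbc.
  have [|abc /subproduct_cmpP h] := @subproduct_cmp_ex _ Q n j ab c.
    by move=> k; have [x [? _]] := cmpA (hab k) (hbc k); exists x.
  exists abc; split; apply/subproduct_cmpP => // k.
  have [x [h1 h2]] := cmpA (hab k) (hbc k).
  by rewrite (is_cmp_fun (h k) h1).
- move=> n j a; apply/subproduct_cmpP => k.
  by rewrite map_refl map_face; apply: cmp_refl_l.
- move=> n j a; apply/subproduct_cmpP => k.
  by rewrite map_refl map_face; apply: cmp_refl_r.
- move=> n i j a b c d ab cd ac bd x y ij h1 h2 h3 h4 h5 h6.
  apply: subproduct_eq => k.
  exact: (interchange ij (map_cmp (pr k) h1) (map_cmp (pr k) h2)
    (map_cmp (pr k) h3) (map_cmp (pr k) h4) (map_cmp (pr k) h5)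
    (map_cmp (pr k) h6)).
- move=> n i j' j a b c ij jj' h; apply/subproduct_cmpP => k.
  by rewrite !map_refl; apply: (refl_cmp_le ij jj'); apply: map_cmp.
- move=> n i j' j a b c ij jj' h; apply/subproduct_cmpP => k.
  by rewrite !map_refl; apply: (refl_cmp_gt ij jj'); apply: map_cmp.
- move=> g n i j j' a b c ij jj' h; apply/subproduct_cmpP => k.
  by rewrite !map_conn; apply: (conn_cmp_lt g ij jj'); apply: map_cmp.
- move=> g n i j j' a b c ij jj' h; apply/subproduct_cmpP => k.
  by rewrite !map_conn; apply: (conn_cmp_gt g ij jj'); apply: map_cmp.
- move=> n j j0 j1 a b c e0 e1 h.
  (* The composites of each factor are the coordinates of [u] and [v], because
     composites are unique. *)
  have tr k := transport_pos e0 e1 (map_cmp (pr k) h).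
  have [|u hu] := @subproduct_cmp_ex _ Q _ j0 (conn Pos j a) (refl j0 a).
    move=> k; have [u [v [? _ _]]] := tr k; exists u.
    by rewrite map_conn map_refl.
  have [|v hv] := @subproduct_cmp_ex _ Q _ j0 (refl j1 a) (conn Pos j b).
    move=> k; have [u' [v [_ ? _]]] := tr k; exists v.
    by rewrite map_conn map_refl.
  exists u, v; split=> //; apply/subproduct_cmpP => k; rewrite map_conn.
  have [u' [v' [h1 h2]]] := tr k.
  have := map_cmp (pr k) hu.
  rewrite map_conn map_refl => /is_cmp_fun/(_ h1) ->.
  have := map_cmp (pr k) hv.
  by rewrite map_conn map_refl => /is_cmp_fun/(_ h2) ->.
- move=> n j j0 j1 a b c e0 e1 h.
  have tr k := transport_neg e0 e1 (map_cmp (pr k) h).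
  have [|u hu] := @subproduct_cmp_ex _ Q _ j0 (conn Neg j a) (refl j1 b).
    move=> k; have [u [v [? _ _]]] := tr k; exists u.
    by rewrite map_conn map_refl.
  have [|v hv] := @subproduct_cmp_ex _ Q _ j0 (refl j0 b) (conn Neg j b).
    move=> k; have [u' [v [_ ? _]]] := tr k; exists v.
    by rewrite map_conn map_refl.
  exists u, v; split=> //; apply/subproduct_cmpP => k; rewrite map_conn.
  have [u' [v' [h1 h2]]] := tr k.
  have := map_cmp (pr k) hu.
  rewrite map_conn map_refl => /is_cmp_fun/(_ h1) ->.
  have := map_cmp (pr k) hv.
  by rewrite map_conn map_refl => /is_cmp_fun/(_ h2) ->.
- move=> n i i0 i1 x e0 e1; apply/subproduct_cmpP => k.
  by rewrite !map_conn map_refl; apply: conn_cmp_conn0.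
- move=> n i i0 i1 x e0 e1; apply/subproduct_cmpP => k.
  by rewrite !map_conn map_refl; apply: conn_cmp_conn1.
Defined.

End StrictCategory.

Section Stretching.
Variables (S : K -> stretching).
Variable Q : subproduct (fun k => st_mag (S k)).
Variable R : subproduct (fun k => st_cat (S k)).

Hypothesis proj_ex : forall n (x : Q n),
  exists y : R n, forall k, sp_val k y = st_proj (S k) n (sp_val k x).
Hypothesis br_ex : forall n (j : 'I_n.+1) (a b : Q n),
  (forall k, par (st_proj (S k)) (sp_val k a) (sp_val k b)) ->
  exists c : Q n.+1,
    forall k, is_br j (sp_val k a) (sp_val k b) (sp_val k c).
Hypothesis brc_ex : forall g n (j : 'I_n.+1) (a b : Q n.+1),
  (forall k, par_at (st_proj (S k)) g j (sp_val k a) (sp_val k b)) ->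
  exists c : Q n.+2,
    forall k, is_brc g j (sp_val k a) (sp_val k b) (sp_val k c).

Local Notation M := (subproduct_magma Q).
Local Notation C := (subproduct_category R).
Local Notation prM := (subproduct_proj Q).
Local Notation prC := (subproduct_proj R).

Let pj n (x : M n) : C n := sval (cid (proj_ex x)).
Let pjE n (x : M n) k : prC k n (pj x) = st_proj (S k) n (prM k n x).
Proof. exact: (svalP (cid (proj_ex x))). Qed.

Let pj_face r n (i : 'I_n.+1) (x : M n.+1) :
  pj (face r i x) = face r i (pj x).
Proof. by apply: subproduct_eq => k; rewrite pjE !map_face pjE. Qed.

Definition subproduct_st_proj : magma_map M C.
Proof.
refine (@MagmaMap M C (CubicalMap pj_face) _ _ _) => /=.
- by move=> n j x; apply: subproduct_eq => k; rewrite pjE !map_refl pjE.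
- by move=> g n j x; apply: subproduct_eq => k; rewrite pjE !map_conn pjE.
- move=> n j a b c h; apply/subproduct_cmpP => k.
  by rewrite !pjE; apply/map_cmp/map_cmp.
Defined.
Local Notation pi := subproduct_st_proj.

Let piE n (x : M n) k : prC k n (pi n x) = st_proj (S k) n (prM k n x).
Proof. exact: pjE. Qed.

(** At level 0 this uses that parallel 0-cells are equal ones, so that joint
    injectivity of the coordinates of [M] is needed instead of that of [C]. *)
Let parP n (a b : M n) :
  par pi a b <-> forall k, par (st_proj (S k)) (prM k n a) (prM k n b).
Proof.
case: n a b => [|n] a b /=; first by split=> [-> //|]; apply: subproduct_eq.
split=> [ab k|ab]; first by rewrite -!piE /= ab.
by apply: subproduct_eq => k; rewrite !pjE.
Qed.

Let par_atP g n (j : 'I_n.+1) (a b : M n.+1) :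
  par_at pi g j a b
  <-> forall k, par_at (st_proj (S k)) g j (prM k n.+1 a) (prM k n.+1 b).
Proof.
split=> [[ab fab] k|ab].
  by split; [exact: (iffLR (parP a b) ab k) | rewrite -!map_face fab].
split; first by apply/parP => k; case: (ab k).
by apply: subproduct_eq => k; rewrite !map_face; case: (ab k).
Qed.

Let bk n (j : 'I_n.+1) (a b : M n) (h : par pi a b) : M n.+1 :=
  sval (cid (br_ex j (iffLR (parP a b) h))).
Let bkE n (j : 'I_n.+1) (a b : M n) (h : par pi a b) k :
  is_br j (prM k n a) (prM k n b) (prM k n.+1 (bk j h)).
Proof. exact: (svalP (cid (br_ex j (iffLR (parP a b) h)))). Qed.

Let bc g n (j : 'I_n.+1) (a b : M n.+1) (h : par_at pi g j a b) : M n.+2 :=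
  sval (cid (brc_ex (iffLR (par_atP g j a b) h))).
Let bcE g n (j : 'I_n.+1) (a b : M n.+1) (h : par_at pi g j a b) k :
  is_brc g j (prM k n.+1 a) (prM k n.+1 b) (prM k n.+2 (bc h)).
Proof. exact: (svalP (cid (brc_ex (iffLR (par_atP g j a b) h)))). Qed.

Let bkP n (j : 'I_n.+1) (a b : M n) c :
  @eq_br M C pi bk n j a b c
  <-> forall k, is_br j (prM k n a) (prM k n b) (prM k n.+1 c).
Proof.
split=> [[h <-] k|abc]; first exact: bkE.
have h : par pi a b by apply/parP => k; case: (abc k).
by exists h; apply: subproduct_eq => k; apply: is_br_fun (abc k); apply: bkE.
Qed.

Let bcP g n (j : 'I_n.+1) (a b : M n.+1) c :
  @eq_brc M C pi bc g n j a b c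
  <-> forall k, is_brc g j (prM k n.+1 a) (prM k n.+1 b) (prM k n.+2 c).
Proof.
split=> [[h <-] k|abc]; first exact: bcE.
have h : par_at pi g j a b by apply/par_atP => k; case: (abc k).
by exists h; apply: subproduct_eq => k; apply: is_brc_fun (abc k); apply: bcE.
Qed.

Definition subproduct_stretching : stretching.
Proof.
refine (@Stretching M C pi bk bc _ _ _ _ _ _ _ _ _ _ _ _ _).
- move=> r n i j i' j' a b h *; apply/bkP => k; rewrite !map_face.
  by have [h' <-] := bkE j h k; apply: face_br_lt.
- move=> r n i j i' j' a b h *; apply/bkP => k; rewrite !map_face.
  by have [h' <-] := bkE j h k; apply: face_br_gt.
- move=> n j a b h; apply: subproduct_eq => k; rewrite map_face.
  by have [h' <-] := bkE j h k; apply: src_br.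
- move=> n j a b h; apply: subproduct_eq => k; rewrite map_face.
  by have [h' <-] := bkE j h k; apply: tgt_br.
- move=> n j a b h; split; apply: subproduct_eq => k; rewrite map_refl !piE.
    by have [h' <-] := bkE j h k; apply: (proj_br j h').1.
  by have [h' <-] := bkE j h k; apply: (proj_br j h').2.
- by move=> n j a; apply/bkP => k; rewrite map_refl; apply: br_refl.
- move=> g n j j0 a b h *; apply: subproduct_eq => k; rewrite map_face.
  by have [h' <-] := bcE h k; apply: face_brc_fst.
- move=> g n j j1 a b h *; apply: subproduct_eq => k; rewrite map_face.
  by have [h' <-] := bcE h k; apply: face_brc_snd.
- move=> g n j i a b h *; apply/bkP => k; rewrite !map_face.
  by have [h' <-] := bcE h k; apply: face_brc_opp.
- move=> r g n i j i' j' a b h *; apply/bcP => k; rewrite !map_face.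
  by have [h' <-] := bcE h k; apply: face_brc_lt.
- move=> r g n i j i' j' a b h *; apply/bcP => k; rewrite !map_face.
  by have [h' <-] := bcE h k; apply: face_brc_gt.
- move=> g n j a b h; split; apply: subproduct_eq => k; rewrite map_conn !piE.
    by have [h' <-] := bcE h k; apply: (proj_brc h').1.
  by have [h' <-] := bcE h k; apply: (proj_brc h').2.
- by move=> g n j a; apply/bcP => k; rewrite map_conn; apply: brc_refl.
Defined.

Definition subproduct_stretching_proj k :
  stretching_map subproduct_stretching (S k).
Proof.
refine (@StretchingMap subproduct_stretching (S k) (prM k) (prC k) _ _ _).
- by move=> n x; rewrite piE.
- by move=> n j a b c /bkP/(_ k).
- by move=> g n j a b c /bcP/(_ k).
Defined.

Lemma subproduct_brP n (j : 'I_n.+1) (a b : M n) c :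
  @is_br subproduct_stretching n j a b c
  <-> forall k, is_br j (prM k n a) (prM k n b) (prM k n.+1 c).
Proof. exact: bkP. Qed.

Lemma subproduct_brcP g n (j : 'I_n.+1) (a b : M n.+1) c :
  @is_brc subproduct_stretching g n j a b c
  <-> forall k, is_brc g j (prM k n.+1 a) (prM k n.+1 b) (prM k n.+2 c).
Proof. exact: bcP. Qed.

End Stretching.

End Subproducts.

(** * Classes of terms *)

(** [rel k t v] reads: the term [t] has the value [v] in the model [k]. *)
Section Fibres.
Variables (T K : Type) (V : K -> Type) (rel : forall k, T -> V k -> Prop).

Definition fibre (v : forall k, V k) (t : T) : Prop := forall k, rel t (v k).

(** A family of values that is named by some term is encoded by the set of all
    its names, which keeps [fibres] in the universe of [T] however large [K]
    and the [V k] are. *)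
Definition fibres : Type :=
  {P : T -> Prop | exists2 v, P = fibre v & exists t, fibre v t}.

Definition fibre_val k (q : fibres) : V k := s2val (cid2 (svalP q)) k.

Lemma fibre_valE (q : fibres) : sval q = fibre (fun k => fibre_val k q).
Proof. exact: (s2valP (cid2 (svalP q))). Qed.

Lemma fibre_inj (p q : fibres) :
  (forall k, fibre_val k p = fibre_val k q) -> p = q.
Proof.
move=> pq; have {pq} : sval p = sval q.
  by rewrite !fibre_valE; congr fibre; apply: functional_extensionality_dep.
by case: p q => [P hP] [P' hP'] /=; apply: eq_exist.
Qed.

Lemma fibre_ex t : (forall k, exists v, rel t (v : V k)) ->
  exists q, forall k, rel t (fibre_val k q).
Proof.
move=> def; pose v k := sval (cid (def k)).
have vt : fibre v t by move=> k; apply: (svalP (cid (def k))).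
pose q : fibres := exist _ (fibre v) (ex_intro2 _ _ v erefl (ex_intro _ t vt)).
by exists q; have : sval q t := vt; rewrite fibre_valE.
Qed.

Lemma fibre_rep (q : fibres) : exists t, forall k, rel t (fibre_val k q).
Proof. exact: (s2valP' (cid2 (svalP q))). Qed.

End Fibres.

(** * The free stretching *)

(** The two cubical sets that underlie a stretching, its magma and its strict
    category, carry a common signature and are treated together. *)
Variant layer := Top | Base.

Record model (X : cubical_set) := Model {
  model_st : stretching;
  model_map : cubical_map X (st_mag model_st)
}.

Section FreeStretching.
Variable X : cubical_set.

(** No composability or parallelism is imposed on terms: those that make no
    sense merely have no value. *)
Inductive term : layer -> nat -> Type :=
| Gen n : X n -> term Top n
| Face l (r : side) n (i : 'I_n.+1) : term l n.+1 -> term l n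
| Refl l n (i : 'I_n.+1) : term l n -> term l n.+1
| Conn l (g : side) n (i : 'I_n.+1) : term l n.+1 -> term l n.+2
| Cmp l n (j : 'I_n.+1) : term l n.+1 -> term l n.+1 -> term l n.+1
| Proj n : term Top n -> term Base n
| Br n (j : 'I_n.+1) : term Top n -> term Top n -> term Top n.+1
| Brc (g : side) n (j : 'I_n.+1) :
    term Top n.+1 -> term Top n.+1 -> term Top n.+2.

Definition layer_mag (S : stretching) (l : layer) : cubical_magma :=
  if l is Top then st_mag S else st_cat S.

Fixpoint value (k : model X) l n (t : term l n) :
    layer_mag (model_st k) l n -> Prop :=
  match t in term l n return layer_mag (model_st k) l n -> Prop with
  | Gen n x => fun c => model_map k n x = c
  | Face l r n i t => fun c => exists2 a, @value k _ _ t a & face r i a = c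
  | Refl l n i t => fun c => exists2 a, @value k _ _ t a & refl i a = c
  | Conn l g n i t => fun c => exists2 a, @value k _ _ t a & conn g i a = c
  | Cmp l n j t u => fun c =>
      exists a b, [/\ @value k _ _ t a, @value k _ _ u b & is_cmp j a b c]
  | Proj n t => fun c =>
      exists2 a : st_mag (model_st k) n, @value k _ _ t a & st_proj _ n a = c
  | Br n j t u => fun c =>
      exists a b : st_mag (model_st k) n,
        [/\ @value k _ _ t a, @value k _ _ u b & is_br j a b c]
  | Brc g n j t u => fun c =>
      exists a b : st_mag (model_st k) n.+1,
        [/\ @value k _ _ t a, @value k _ _ u b & is_brc g j a b c]
  end.
Arguments value k {l n} t _.

Lemma value_fun k l n (t : term l n) c d : value k t c -> value k t d -> c = d.
Proof.
elim: t c d => {l n} /=.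
- by move=> n x c d <- <-.
- by move=> l r n i t IH c d [a /IH ta <-] [b /ta <- <-].
- by move=> l n i t IH c d [a /IH ta <-] [b /ta <- <-].
- by move=> l g n i t IH c d [a /IH ta <-] [b /ta <- <-].
- move=> l n j t IHt u IHu c d [a [b [/IHt ta /IHu ub h]]].
  by move=> [a' [b' [/ta <- /ub <-]]]; apply: is_cmp_fun.
- by move=> n t IH c d [a /IH ta <-] [b /ta <- <-].
- move=> n j t IHt u IHu c d [a [b [/IHt ta /IHu ub h]]].
  by move=> [a' [b' [/ta <- /ub <-]]]; apply: is_br_fun.
- move=> g n j t IHt u IHu c d [a [b [/IHt ta /IHu ub h]]].
  by move=> [a' [b' [/ta <- /ub <-]]]; apply: is_brc_fun.
Qed.

Definition free_cell l n : Type :=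
  fibres (fun k => @value k l n).

Definition free_val l k n (q : free_cell l n) : layer_mag (model_st k) l n :=
  fibre_val k q.

(** A term that has a value with the property [P k] in each model [k] defines a
    free cell, whose values then have these properties as well because values
    are unique. *)
Lemma free_cell_ex l n (t : term l n)
    (P : forall k, layer_mag (model_st k) l n -> Prop) :
  (forall k, exists2 c, value k t c & P k c) ->
  exists q : free_cell l n,
    (forall k, value k t (free_val k q)) /\ forall k, P k (free_val k q).
Proof.
move=> tP; have [|q tq] := @fibre_ex _ _ _ (fun k => @value k l n) t.
  by move=> k; have [c tc _] := tP k; exists c.
exists q; split=> // k; have [c tc Pc] := tP k.
by rewrite /free_val (value_fun (tq k) tc).
Qed.

(** Closure under the operations: a name of the result is obtained by applying
    the corresponding term former to names of the arguments. *)
Definition free_subproduct l :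
    subproduct (fun k : model X => layer_mag (model_st k) l).
Proof.
refine (@Subproduct _ _ (free_cell l) (@free_val l) _ _ _ _ _).
- by move=> n x y; apply: fibre_inj.
- move=> r n i x; have [t tx] := fibre_rep x.
  have [|y [_ yP]] := @free_cell_ex l n (Face r i t)
    (fun k c => c = face r i (free_val k x)); last by exists y.
  by move=> k; eexists=> //; exists (free_val k x); first exact: tx.
- move=> n i x; have [t tx] := fibre_rep x.
  have [|y [_ yP]] := @free_cell_ex l _ (Refl i t)
    (fun k c => c = refl i (free_val k x)); last by exists y.
  by move=> k; eexists=> //; exists (free_val k x); first exact: tx.
- move=> g n i x; have [t tx] := fibre_rep x.
  have [|y [_ yP]] := @free_cell_ex l _ (Conn g i t)
    (fun k c => c = conn g i (free_val k x)); last by exists y.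
  by move=> k; eexists=> //; exists (free_val k x); first exact: tx.
- move=> n j a b ab; have [t ta] := fibre_rep a; have [u ub] := fibre_rep b.
  have [|y [_ yP]] := @free_cell_ex l _ (Cmp j t u)
    (fun k c => is_cmp j (free_val k a) (free_val k b) c); last by exists y.
  move=> k; have abc : is_cmp j (free_val k a) (free_val k b) (cmp j (ab k)).
    by exists (ab k).
  by eexists; last exact: abc; exists (free_val k a), (free_val k b).
Defined.

Let proj_ex n (x : free_cell Top n) : exists y : free_cell Base n,
  forall k, free_val k y = st_proj (model_st k) n (free_val k x).
Proof.
have [t tx] := fibre_rep x.
have [|y [_ yP]] := @free_cell_ex Base _ (Proj t)
  (fun k c => c = st_proj (model_st k) n (free_val k x)); last by exists y.
by move=> k; eexists=> //; exists (free_val k x); first exact: tx.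
Qed.

Let br_ex n (j : 'I_n.+1) (a b : free_cell Top n) :
  (forall k, par (st_proj (model_st k)) (free_val k a) (free_val k b)) ->
  exists c : free_cell Top n.+1,
    forall k, @is_br (model_st k) n j (free_val k a) (free_val k b)
                (free_val k c).
Proof.
move=> ab; have [t ta] := fibre_rep a; have [u ub] := fibre_rep b.
have [|y [_ yP]] := @free_cell_ex Top _ (Br j t u) (fun k c =>
  @is_br (model_st k) n j (free_val k a) (free_val k b) c); last by exists y.
move=> k; have abc : is_br j (free_val k a) (free_val k b) (br j (ab k)).
  by exists (ab k).
by eexists; last exact: abc; exists (free_val k a), (free_val k b).
Qed.

Let brc_ex g n (j : 'I_n.+1) (a b : free_cell Top n.+1) :
  (forall k, par_at (st_proj (model_st k)) g j (free_val k a) (free_val k b)) ->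
  exists c : free_cell Top n.+2,
    forall k, @is_brc (model_st k) g n j (free_val k a) (free_val k b)
                (free_val k c).
Proof.
move=> ab; have [t ta] := fibre_rep a; have [u ub] := fibre_rep b.
have [|y [_ yP]] := @free_cell_ex Top _ (Brc g j t u) (fun k c =>
  @is_brc (model_st k) g n j (free_val k a) (free_val k b) c); last by exists y.
move=> k; have abc : is_brc g j (free_val k a) (free_val k b) (brc g j (ab k)).
  by exists (ab k).
by eexists; last exact: abc; exists (free_val k a), (free_val k b).
Qed.

Definition free_stretching : stretching :=
  @subproduct_stretching (model X) (@model_st X)
    (free_subproduct Top) (free_subproduct Base) proj_ex br_ex brc_ex.

Definition free_eval k : stretching_map free_stretching (model_st k) :=
  @subproduct_stretching_proj (model X) (@model_st X)
    (free_subproduct Top) (free_subproduct Base) proj_ex br_ex brc_ex k.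

Let gen_ex n (x : X n) : exists q : free_cell Top n,
  forall k, free_val k q = model_map k n x.
Proof.
have [|q [_ qP]] := @free_cell_ex Top _ (Gen x)
  (fun k c => c = model_map k n x); last by exists q.
by move=> k; eexists.
Qed.

Let gen n (x : X n) : st_mag free_stretching n := sval (cid (gen_ex x)).

Let genE k n (x : X n) : sm_mag (free_eval k) n (gen x) = model_map k n x.
Proof. exact: (svalP (cid (gen_ex x))). Qed.

Lemma free_top_eq n (x y : st_mag free_stretching n) :
  (forall k, sm_mag (free_eval k) n x = sm_mag (free_eval k) n y) -> x = y.
Proof. exact: fibre_inj. Qed.

Let gen_face r n (i : 'I_n.+1) (x : X n.+1) :
  gen (face r i x) = face r i (gen x).
Proof. by apply: free_top_eq => k; rewrite map_face !genE map_face. Qed.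

Definition free_unit : cubical_map X (st_mag free_stretching) :=
  CubicalMap gen_face.

Lemma free_unitE k n (x : X n) :
  sm_mag (free_eval k) n (free_unit n x) = model_map k n x.
Proof. exact: genE. Qed.

Definition layer_map S T (g : stretching_map S T) l :
    magma_map (layer_mag S l) (layer_mag T l) :=
  match l with Top => sm_mag g | Base => sm_cat g end.

Local Notation ev k l := (layer_map (free_eval k) l).

Lemma free_eq l n (x y : layer_mag free_stretching l n) :
  (forall k, ev k l n x = ev k l n y) -> x = y.
Proof. by case: l x y => x y; apply: fibre_inj. Qed.

Lemma free_cmpP l n (j : 'I_n.+1) (a b c : layer_mag free_stretching l n.+1) :
  (forall k, is_cmp j (ev k l _ a) (ev k l _ b) (ev k l _ c)) -> is_cmp j a b c.
Proof. by case: l a b c => a b c h; apply/subproduct_cmpP. Qed.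

Lemma free_brP n (j : 'I_n.+1) (a b : st_mag free_stretching n) c :
  (forall k, is_br j (sm_mag (free_eval k) n a) (sm_mag (free_eval k) n b)
    (sm_mag (free_eval k) n.+1 c)) -> is_br j a b c.
Proof. by move=> h; apply/subproduct_brP. Qed.

Lemma free_brcP g n (j : 'I_n.+1) (a b : st_mag free_stretching n.+1) c :
  (forall k, is_brc g j (sm_mag (free_eval k) n.+1 a)
    (sm_mag (free_eval k) n.+1 b) (sm_mag (free_eval k) n.+2 c)) ->
  is_brc g j a b c.
Proof. by move=> h; apply/subproduct_brcP. Qed.

(** [free_cell_ex], seen in the stretching [free_stretching]. *)
Lemma free_rep l n (t : term l n)
    (P : forall k, layer_mag (model_st k) l n -> Prop) :
  (forall k, exists2 c, value k t c & P k c) ->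
  exists q : layer_mag free_stretching l n,
    (forall k, value k t (ev k l n q)) /\ forall k, P k (ev k l n q).
Proof. by case: l t P => t P; apply: free_cell_ex. Qed.

(* From here on free cells are only reached through their values in the models
   and the terms that name them. *)
Opaque free_stretching free_eval free_unit.

(** Evaluation is the only morphism that extends [model_map k].  The induction
    is on a term [t] naming [q]: as [t] has a value in every model, so do its
    immediate subterms, which thus name free cells from which [q] is obtained
    by the operation at the head of [t]; both morphisms preserve it. *)
Lemma free_map_eval k (g : stretching_map free_stretching (model_st k)) :
  (forall n (x : X n), sm_mag g n (free_unit n x) = model_map k n x) ->
  forall l n (t : term l n) (q : layer_mag free_stretching l n),
    (forall k', value k' t (ev k' l n q)) ->
    layer_map g l n q = ev k l n q.
Proof.
move=> gX l n t; elim: t => {l n} /=.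
- move=> n x q qx; have -> : q = free_unit n x.
    by apply: free_top_eq => k'; rewrite free_unitE (qx k').
  by rewrite gX; exact: esym (free_unitE k x).
- move=> l r n i t IH q /free_rep[a [ta aq]].
  have -> : q = face r i a by apply: free_eq => k'; rewrite map_face aq.
  by rewrite !map_face IH.
- move=> l n i t IH q /free_rep[a [ta aq]].
  have -> : q = refl i a by apply: free_eq => k'; rewrite map_refl aq.
  by rewrite !map_refl IH.
- move=> l s n i t IH q /free_rep[a [ta aq]].
  have -> : q = conn s i a by apply: free_eq => k'; rewrite map_conn aq.
  by rewrite !map_conn IH.
- move=> l n j t IHt u IHu q qP.
  (* The second subterm is handled inside the property of the first, so that
     both values in a model come from the same composition there. *)
  have [|a [ta aq]] := @free_rep l _ t
    (fun k' a => exists2 b, value k' u b & is_cmp j a b (ev k' l _ q)).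
    by move=> k'; have [a [b [? ? ?]]] := qP k'; exists a => //; exists b.
  have [b [ub abq]] := free_rep aq.
  have {}abq := free_cmpP abq.
  have := map_cmp (layer_map g l) abq; rewrite IHt // IHu //.
  by move/is_cmp_fun; apply; apply: map_cmp.
- move=> n t IH q qP; have [a [ta aq]] := @free_rep Top _ t _ qP.
  have -> : q = st_proj free_stretching n a.
    apply: (@free_eq Base) => k'.
    exact: etrans (esym (aq k')) (sm_proj (free_eval k') a).
  rewrite -[LHS](sm_proj g) -[RHS](sm_proj (free_eval k)).
  by congr (st_proj _ _ _); apply: IH.
- move=> n j t IHt u IHu q qP.
  have [|a [ta aq]] := @free_rep Top _ t
    (fun k' a => exists2 b, value k' u b &
      @is_br (model_st k') n j a b (ev k' Top _ q)).
    by move=> k'; have [a [b [? ? ?]]] := qP k'; exists a => //; exists b.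
  have [b [ub abq]] := @free_rep Top _ _ _ aq.
  have {}abq : @is_br free_stretching n j a b q := free_brP abq.
  have := map_br g abq; rewrite (IHt a ta) (IHu b ub) => gq.
  exact: is_br_fun gq (map_br (free_eval k) abq).
- move=> s n j t IHt u IHu q qP.
  have [|a [ta aq]] := @free_rep Top _ t
    (fun k' a => exists2 b, value k' u b &
      @is_brc (model_st k') s n j a b (ev k' Top _ q)).
    by move=> k'; have [a [b [? ? ?]]] := qP k'; exists a => //; exists b.
  have [b [ub abq]] := @free_rep Top _ _ _ aq.
  have {}abq : @is_brc free_stretching s n j a b q := free_brcP abq.
  have := map_brc g abq; rewrite (IHt a ta) (IHu b ub) => gq.
  exact: is_brc_fun gq (map_brc (free_eval k) abq).
Qed.

Lemma free_map_uniq k (g : stretching_map free_stretching (model_st k)) :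
  (forall n (x : X n), sm_mag g n (free_unit n x) = model_map k n x) ->
  g = free_eval k.
Proof.
move=> gX; apply: stretching_mapP => n x; have [t tx] := fibre_rep x.
  exact: (@free_map_eval k g gX Top n t x tx).
exact: (@free_map_eval k g gX Base n t x tx).
Qed.

End FreeStretching.

Lemma free_universal (X : CSets) (A : CEtC) (f : hom X (forget A)) :
  exists! g : @hom CEtC (free_stretching X) A,
    @compm CSets X (forget (free_stretching X)) (forget A)
      (fmap forget g) (free_unit X) = f.
Proof.
exists (free_eval (Model f)); split.
  by apply: cubical_mapP => n x; exact: (free_unitE (Model f)).
move=> g gf; symmetry; apply: (@free_map_uniq X (Model f)) => n x.
by rewrite /= -gf.
Qed.

Theorem proposition2 :
  exists (F : functor CSets CEtC)
         (eta : nat_trans (functor_id CSets) (forget \oF F))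
         (eps : nat_trans (F \oF forget) (functor_id CEtC)),
    is_adjunction eta eps /\
    exists nu : nat_trans ((forget \oF F) \oF (forget \oF F)) (forget \oF F),
      (forall X, nu X = fmap forget (eps (F X))) /\ is_monad eta nu.
Proof.
exact: (@universal_adjunction_monad CSets CEtC forget free_stretching
  free_unit free_universal).
Qed.
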